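(* Let $q\in\mathbb C$ with $\operatorname{Re} q>0$, let $f$ be a generator on $\mathbb D$ with $f(0)=0$ and $f'(0)=q$, and let $G_r=(\mathrm{Id}+rf)^{-1}$, $r>0$, be its resolvents. For any $r>\frac{2}{\operatorname{Re} q}$ we have $$|G_r(z)|\le \frac{3}{1+r\operatorname{Re} q}\qquad\text{for all } z\in\mathbb D .$$ Thus $G_r$ (for such $r$) has no boundary fixed points, and the net $\{G_r\}_{r>0}$ converges to zero uniformly on $\mathbb D$ as $r\to\infty$.
   Context: $\mathbb D=\{z\in\mathbb C:|z|<1\}$. Generators $f$ on $\mathbb D$ with $f(0)=0$, $f'(0)=q$, $\operatorname{Re} q>0$, are exactly the functions $f(z)=zp(z)$ with $p:\mathbb D\to\mathbb C$ holomorphic, $\operatorname{Re} p(z)\ge0$ on $\mathbb D$ and $p(0)=q$. It is known that for every such $f$ and every $r>0$ there is a unique holomorphic map $G_r:\mathbb D\to\mathbb D$ satisfying $G_r(w)+rf(G_r(w))=w$ for all $w\in\mathbb D$; it is univalent with $G_r(0)=0$, is written $G_r=(\mathrm{Id}+rf)^{-1}$, and is called the nonlinear resolvent of $f$ with parameter $r$. A boundary fixed point of $G_r$ is a point $\zeta$ with $|\zeta|=1$ such that the radial limit $\lim_{s\to1^-}G_r(s\zeta)$ exists and equals $\zeta$. *)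

(* Defs.v *)
(* Stdlib reals, with Coquelicot's complex numbers. *)
From Stdlib Require Import Reals Lra.
From Coquelicot Require Import Coquelicot.

Local Open Scope C_scope.

Definition unit_disk (z : C) : Prop := (Cmod z < 1)%R.

Definition holomorphic_on (A : C -> Prop) (f : C -> C) : Prop :=
  forall z : C, A z -> @ex_derive C_AbsRing C_NormedModule f z.

(* Generators on the unit disk that vanish at the origin with derivative [q]
   there, in Berkson-Porta form. The properties [f 0 = 0] and [f'(0) = q] are
   derived below. Only the values of [f] on the disk matter. *)
Definition generator (q : C) (f : C -> C) : Prop :=
  exists p : C -> C,
    holomorphic_on unit_disk p /\
    (forall z : C, unit_disk z -> (0 <= Re (p z))%R) /\
    p 0 = q /\
    (forall z : C, unit_disk z -> f z = z * p z).

(* [G = (Id + r f)^{-1}] as a self-map of the disk; for a generator [f] and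
   [r > 0] such a [G] exists and is unique on the disk. *)
Definition resolvent (f : C -> C) (r : R) (G : C -> C) : Prop :=
  holomorphic_on unit_disk G /\
  (forall w : C, unit_disk w -> unit_disk (G w)) /\
  (forall w : C, unit_disk w -> G w + RtoC r * f (G w) = w).

Definition boundary_fixed_point (G : C -> C) (zeta : C) : Prop :=
  Cmod zeta = 1%R /\
  filterlim (fun s : R => G (RtoC s * zeta)) (at_left 1) (locally zeta).

Definition unif_cvg_at_infty (A : C -> Prop) (G : R -> C -> C) (g : C -> C) :
    Prop :=
  forall eps : posreal,
    Rbar_locally p_infty
      (fun r : R => forall z : C, A z -> (Cmod (G r z - g z) < eps)%R).

Lemma unit_disk_0 : unit_disk 0.
Proof. unfold unit_disk; rewrite Cmod_0; lra. Qed.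

Lemma generator_0 (q : C) (f : C -> C) : generator q f -> f 0 = 0.
Proof.
  intros (p & _ & _ & _ & Hf).
  rewrite (Hf _ unit_disk_0); ring.
Qed.

Lemma generator_derive_0 (q : C) (f : C -> C) :
  generator q f -> @is_derive C_AbsRing C_NormedModule f (RtoC 0) q.
Proof.
  intros Hgen.
  pose proof (generator_0 q f Hgen) as Hf0.
  destruct Hgen as (p & Hp & _ & Hp0 & Hf).
  split; [apply is_linear_scal_l|].
  intros x Hx.
  assert (Ex : RtoC 0 = x).
  { apply (is_filter_lim_locally_unique (V := AbsRing_NormedModule C_AbsRing)).
    exact Hx. }
  subst x. intros eps.
  assert (Hc : filterlim p (@locally (AbsRing_UniformSpace C_AbsRing) (RtoC 0))
                 (@locally (NormedModule.UniformSpace _ C_NormedModule) (p (RtoC 0)))).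
  { apply (ex_derive_continuous (K := C_AbsRing) (V := C_NormedModule)).
    apply Hp, unit_disk_0. }
  assert (He := Hc _ (locally_ball_norm (V := C_NormedModule) (p (RtoC 0)) eps)).
  assert (Hd : @locally (AbsRing_UniformSpace C_AbsRing) (RtoC 0) unit_disk).
  { exists (mkposreal 1 Rlt_0_1); intros y Hy.
    unfold ball in Hy; simpl in Hy; unfold AbsRing_ball, abs, minus, plus, opp in Hy;
    simpl in Hy.
    unfold unit_disk; replace y with (y + - RtoC 0) by ring; exact Hy. }
  generalize (filter_and _ _ Hd He); apply filter_imp.
  intros y [Hy1 Hy2].
  unfold ball_norm in Hy2.
  change (Cmod (p y - p (RtoC 0)) < eps)%R in Hy2.
  change (Cmod ((f y - f (RtoC 0)) - (y - RtoC 0) * q)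
          <= eps * Cmod (y - RtoC 0))%R.
  rewrite (Hf y Hy1), Hf0, <- Hp0.
  replace (y * p y - RtoC 0 - (y - RtoC 0) * p (RtoC 0))
    with ((p y - p (RtoC 0)) * (y - RtoC 0)) by ring.
  rewrite Cmod_mult.
  apply Rmult_le_compat_r; [apply Cmod_ge_0 | lra].
Qed.

(* Main.v *)
(** With [u = G_r z] we have [z = u (1 + r p(u))], so that
    [|u| (1 + r Re p(u)) <= |z| < 1]. Harnack's inequality
    [Re p(u) >= Re q (1 - |u|) / (1 + |u|)] turns this into
    [|u| (r Re q - 1) < 1], and [1 / (r Re q - 1) <= 3 / (1 + r Re q)] as soon as
    [r Re q >= 2].

    Harnack's inequality is Schwarz's lemma for [(p - q) / (p + conj q)], hence
    rests on the maximum principle. As holomorphic only means complex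
    differentiable, the mean value property behind it comes from Goursat's
    bisection, carried out in the logarithmic coordinates [c + exp (s + i t)].
    These see the centre [c] only in the limit [s -> -oo], where continuity is
    enough: so the removable singularity of [w(z) / z] in Schwarz's lemma
    requires no separate treatment. *)

Require Import Defs.
From Stdlib Require Import Reals Lra Lia ClassicalEpsilon Classical.
From Coquelicot Require Import Coquelicot.

Local Open Scope R_scope.

(** * Circulation of closed forms on rectangles *)

(** The supremum of the left endpoints works: any left endpoint is at most any right endpoint, as
    comparison at the later of the two indices shows. *)
Lemma nested_intervals (a d : nat -> R) :
  (forall n, 0 <= d n) ->
  (forall n, a n <= a (S n)) ->
  (forall n, a (S n) + d (S n) <= a n + d n) ->
  exists c, forall n, a n <= c <= a n + d n.
Proof.
intros Hd Ha Hb.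
assert (Hmono : forall n k, a n <= a (n + k)%nat).
{ intros n k; induction k as [|k IH]; [rewrite Nat.add_0_r; lra|].
  rewrite Nat.add_succ_r; specialize (Ha (n + k)%nat); lra. }
assert (Hanti : forall n k, a (n + k)%nat + d (n + k)%nat <= a n + d n).
{ intros n k; induction k as [|k IH]; [rewrite Nat.add_0_r; lra|].
  rewrite Nat.add_succ_r; specialize (Hb (n + k)%nat); lra. }
assert (Hle : forall n k, a n <= a k + d k).
{ intros n k; destruct (Nat.le_ge_cases n k) as [H|H].
  - specialize (Hmono n (k - n)%nat); specialize (Hd k).
    replace (n + (k - n))%nat with k in Hmono by lia; lra.
  - specialize (Hanti k (n - k)%nat); specialize (Hd n).
    replace (k + (n - k))%nat with n in Hanti by lia; lra. }
destruct (completeness (fun r => exists n, r = a n)) as [c [Hc1 Hc2]].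
- exists (a O + d O); intros r [n ->]; apply Hle.
- exists (a O), O; reflexivity.
- exists c; intros n; split.
  + apply Hc1; exists n; reflexivity.
  + apply Hc2; intros r [k ->]; apply Hle.
Qed.

Lemma pow_half_small (e : R) : 0 < e -> exists n, (/ 2) ^ n < e.
Proof.
intros He.
destruct (pow_lt_1_zero (/ 2)) with (y := e) as [n Hn]; [|exact He|].
- rewrite Rabs_pos_eq; lra.
- exists n; specialize (Hn n (Nat.le_refl n)).
  rewrite Rabs_pos_eq in Hn; [exact Hn|]; apply pow_le; lra.
Qed.

(* [P x y t] is a property of the rectangle [x, x + t l] x [y, y + t m]; all
   rectangles considered have the same proportions. *)
Lemma rectangle_induction (l m : R) (P : R -> R -> R -> Prop) :
  0 <= l -> 0 <= m ->
  (forall x y t, 0 < t ->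
     P x y t -> P (x + t * l) y t -> P x (y + t * m) t ->
     P (x + t * l) (y + t * m) t -> P x y (2 * t)) ->
  forall x y,
  (forall u v, x <= u <= x + l -> y <= v <= y + m ->
     exists d, 0 < d /\ forall x' y' t, 0 < t < d ->
       x' <= u <= x' + t * l -> y' <= v <= y' + t * m -> P x' y' t) ->
  P x y 1.
Proof.
intros Hl Hm Hstep x y Hloc.
apply NNPP; intros Hbad.
pose (bad := fun p : R * R * R => 0 < snd p /\ ~ P (fst (fst p)) (snd (fst p)) (snd p)).
pose (sub := fun p p' : R * R * R =>
  snd p' = snd p / 2 /\
  fst (fst p) <= fst (fst p') <= fst (fst p) + snd p / 2 * l /\
  snd (fst p) <= snd (fst p') <= snd (fst p) + snd p / 2 * m).
(* A bad rectangle has a bad quarter, since four good quarters would make it good. The existential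
   stands outside the implication so that choice yields a total function [next]. *)
assert (Hex : forall p, exists p', bad p -> bad p' /\ sub p p').
{ intros [[x0 y0] t]; destruct (classic (bad (x0, y0, t))) as [[Ht Hb]|Hb];
    [|exists (x0, y0, t); tauto].
  simpl in Ht, Hb.
  pose proof (Rmult_le_pos (t / 2) l ltac:(lra) Hl).
  pose proof (Rmult_le_pos (t / 2) m ltac:(lra) Hm).
  apply NNPP; intros Hno; apply Hb.
  replace t with (2 * (t / 2)) by field.
  apply Hstep; [lra| | | |]; apply NNPP; intros H'; apply Hno;
  [ exists (x0, y0, t / 2) | exists (x0 + t / 2 * l, y0, t / 2)
  | exists (x0, y0 + t / 2 * m, t / 2) | exists (x0 + t / 2 * l, y0 + t / 2 * m, t / 2) ];
  intros _; unfold bad, sub; simpl; repeat split; try lra; exact H'. }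
pose (next := fun p => proj1_sig (constructive_indefinite_description _ (Hex p))).
assert (Hnext : forall p, bad p -> bad (next p) /\ sub p (next p)).
{ intros p; exact (proj2_sig (constructive_indefinite_description _ (Hex p))). }
pose (p := fix p n := match n with O => (x, y, 1) | S n => next (p n) end).
assert (Hp : forall n, bad (p n)).
{ induction n as [|n IH]; [split; simpl; [lra|exact Hbad]|].
  exact (proj1 (Hnext _ IH)). }
assert (Hs : forall n, sub (p n) (p (S n))) by (intros n; exact (proj2 (Hnext _ (Hp n)))).
assert (Ht : forall n, snd (p n) = (/ 2) ^ n).
{ induction n as [|n IH]; [reflexivity|].
  destruct (Hs n) as [H _]; rewrite H, IH; simpl; field. }
(* The bad rectangles are nested with scale [(/ 2) ^ n] and share a point [(u, v)]; there [Hloc]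
   makes every small enough rectangle good, a contradiction. *)
destruct (nested_intervals (fun n => fst (fst (p n))) (fun n => snd (p n) * l))
  as [u Hu].
{ intros n; apply Rmult_le_pos; [destruct (Hp n); lra|exact Hl]. }
{ intros n; destruct (Hs n); lra. }
{ intros n; destruct (Hs n) as [H [H' _]]; rewrite H; lra. }
destruct (nested_intervals (fun n => snd (fst (p n))) (fun n => snd (p n) * m))
  as [v Hv].
{ intros n; apply Rmult_le_pos; [destruct (Hp n); lra|exact Hm]. }
{ intros n; destruct (Hs n) as [_ [_ H]]; lra. }
{ intros n; destruct (Hs n) as [H [_ H']]; rewrite H; lra. }
destruct (Hloc u v) as [d [Hd HP]].
- specialize (Hu O); simpl in Hu; lra.
- specialize (Hv O); simpl in Hv; lra.
- destruct (pow_half_small d Hd) as [n Hn].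
  destruct (Hp n) as [Hn0 Hn1]; apply Hn1, HP; auto.
  rewrite Ht in *; lra.
Qed.

(** The counterclockwise integral of the form [V ds + U dt] along the boundary of the rectangle,
    with opposite sides paired. *)
Definition circulation (U V : R -> R -> R) (x y l m : R) : R :=
  RInt (fun t => U (x + l) t - U x t) y (y + m) -
  RInt (fun s => V s (y + m) - V s y) x (x + l).

(** The common side at [x + l] is traversed in both directions and cancels; the horizontal sides
    concatenate. The continuity hypotheses provide integrability along the sides. *)
Lemma circulation_split_l (U V : R -> R -> R) (x y l l' m : R) :
  (forall s t, x <= s <= x + (l + l') -> continuous (U s) t) ->
  (forall s t, x <= s <= x + (l + l') -> continuous (fun s => V s t) s) ->
  0 <= l -> 0 <= l' ->
  circulation U V x y (l + l') m =
  circulation U V x y l m + circulation U V (x + l) y l' m.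
Proof.
intros HU HV Hl Hl'; unfold circulation.
assert (EU : forall s s', x <= s <= x + (l + l') -> x <= s' <= x + (l + l') ->
  ex_RInt (fun t => U s t - U s' t) y (y + m)).
{ intros s s' Hs Hs'; apply (ex_RInt_continuous (V := R_CompleteNormedModule)).
  intros z _; apply (continuous_minus (U s) (U s')); apply HU; lra. }
assert (EV : forall a b, x <= a <= b -> b <= x + (l + l') ->
  ex_RInt (fun s => V s (y + m) - V s y) a b).
{ intros a b Ha Hb; apply (ex_RInt_continuous (V := R_CompleteNormedModule)).
  rewrite Rmin_left, Rmax_right by lra; intros z Hz.
  apply (continuous_minus (fun s => V s (y + m)) (fun s => V s y)); apply HV; lra. }
replace (x + (l + l')) with (x + l + l') in * by ring.
rewrite <- (RInt_Chasles (fun s => V s (y + m) - V s y) x (x + l) (x + l + l'))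
  by (apply EV; lra).
change plus with Rplus.
replace (RInt (fun t => U (x + l + l') t - U x t) y (y + m)) with
  (RInt (fun t => U (x + l) t - U x t) y (y + m) +
   RInt (fun t => U (x + l + l') t - U (x + l) t) y (y + m)); [ring|].
rewrite <- (RInt_plus (V := R_CompleteNormedModule)) by (apply EU; lra).
apply RInt_ext; intros t _; unfold plus; simpl; ring.
Qed.

Lemma circulation_split_m (U V : R -> R -> R) (x y l m m' : R) :
  (forall s t, x <= s <= x + l -> continuous (U s) t) ->
  (forall s t, x <= s <= x + l -> continuous (fun s => V s t) s) ->
  0 <= l -> 0 <= m -> 0 <= m' ->
  circulation U V x y l (m + m') =
  circulation U V x y l m + circulation U V x (y + m) l m'.
Proof.
intros HU HV Hl Hm Hm'; unfold circulation.
assert (EU : forall a b, ex_RInt (fun t => U (x + l) t - U x t) a b).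
{ intros a b; apply (ex_RInt_continuous (V := R_CompleteNormedModule)).
  intros z _; apply (continuous_minus (U (x + l)) (U x)); apply HU; lra. }
assert (EV : forall t t', ex_RInt (fun s => V s t - V s t') x (x + l)).
{ intros t t'; apply (ex_RInt_continuous (V := R_CompleteNormedModule)).
  rewrite Rmin_left, Rmax_right by lra; intros z Hz.
  apply (continuous_minus (fun s => V s t) (fun s => V s t')); apply HV; lra. }
replace (y + (m + m')) with (y + m + m') in * by ring.
rewrite <- (RInt_Chasles (fun t => U (x + l) t - U x t) y (y + m) (y + m + m'))
  by apply EU.
change plus with Rplus.
replace (RInt (fun s => V s (y + m + m') - V s y) x (x + l)) with
  (RInt (fun s => V s (y + m) - V s y) x (x + l) +
   RInt (fun s => V s (y + m + m') - V s (y + m)) x (x + l)); [ring|].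
rewrite <- (RInt_plus (V := R_CompleteNormedModule)) by apply EV.
apply RInt_ext; intros t _; unfold plus; simpl; ring.
Qed.

(** * Differentiability in two real variables and Goursat's estimate *)

Lemma differentiable_continuous_l (F : R -> R -> R) (x y lx ly : R) :
  differentiable_pt_lim F x y lx ly -> continuous (fun s => F s y) x.
Proof.
intros HF; apply continuity_pt_filterlim, derivable_continuous_pt; exists lx.
(* The slice is regarded as a function of two variables, constant in the second, with partial
   derivatives [lx] and [0]. *)
apply (differentiable_pt_lim_proj1_1 (fun s => F s y) x y).
unfold differentiable_pt_lim in *; intros e; destruct (HF e) as [d Hd].
exists d; intros u v Hu Hv; specialize (Hd u y Hu).
rewrite Rminus_diag, Rabs_R0 in Hd; specialize (Hd (cond_pos d)).
replace (lx * (u - x) + 0 * (v - y)) with (lx * (u - x) + ly * 0) by ring.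
eapply Rle_trans; [exact Hd|].
apply Rmult_le_compat_l; [left; apply cond_pos|].
apply Rle_max_compat_l, Rabs_pos.
Qed.

Lemma differentiable_swap (F : R -> R -> R) (x y lx ly : R) :
  differentiable_pt_lim F x y lx ly ->
  differentiable_pt_lim (fun v u => F u v) y x ly lx.
Proof.
intros HF e; destruct (HF e) as [d Hd]; exists d; intros v u Hv Hu.
rewrite Rmax_comm, (Rplus_comm (ly * _)); apply Hd; assumption.
Qed.

Lemma differentiable_continuous_r (F : R -> R -> R) (x y lx ly : R) :
  differentiable_pt_lim F x y lx ly -> continuous (F x) y.
Proof.
intros HF.
apply (differentiable_continuous_l (fun v u => F u v) y x ly lx).
apply differentiable_swap, HF.
Qed.

Lemma RInt_near_const (f : R -> R) (a b c e : R) :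
  a <= b -> ex_RInt f a b -> (forall t, a <= t <= b -> Rabs (f t - c) <= e) ->
  Rabs (RInt f a b - (b - a) * c) <= (b - a) * e.
Proof.
intros Hab Hf Hc.
assert (E : RInt (fun t => f t - c) a b = RInt f a b - (b - a) * c).
{ rewrite <- (RInt_const (V := R_CompleteNormedModule) a b c : _ = (b - a) * c).
  apply (RInt_minus (V := R_CompleteNormedModule) f (fun _ => c));
    [exact Hf|apply ex_RInt_const]. }
rewrite <- E; apply abs_RInt_le_const; [exact Hab| |exact Hc].
apply (ex_RInt_minus (V := R_CompleteNormedModule) f (fun _ => c));
  [exact Hf|apply ex_RInt_const].
Qed.

(* Goursat's argument: the linear parts of [U] and [V] at a point contribute
   nothing, so a rectangle shrinking to that point has circulation
   [o(diameter ^ 2)]. *)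
Lemma circulation_closed (U V : R -> R -> R) (S : R) :
  (forall s t, s < S -> exists A B C,
     differentiable_pt_lim U s t A B /\ differentiable_pt_lim V s t C A) ->
  forall x y l m, 0 < l -> 0 < m -> x + l < S -> circulation U V x y l m = 0.
Proof.
intros HD x y l m Hl Hm HS.
assert (CU : forall s t, s < S -> continuous (U s) t).
{ intros s t Hs; destruct (HD s t Hs) as (A & B & C & HU & _).
  exact (differentiable_continuous_r _ _ _ _ _ HU). }
assert (CV : forall s t, s < S -> continuous (fun s => V s t) s).
{ intros s t Hs; destruct (HD s t Hs) as (A & B & C & _ & HV).
  exact (differentiable_continuous_l _ _ _ _ _ HV). }
assert (Hall : forall e, 0 < e -> Rabs (circulation U V x y l m) <= e).
{ intros e He.
  (* The bound scales like the area, so that the bounds of four quarters add up to that of the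
     whole. The premise keeps every rectangle in the half-plane where [HD] applies. *)
  pose (P := fun x y t => x + t * l < S ->
    Rabs (circulation U V x y (t * l) (t * m)) <= e * t ^ 2).
  enough (HP : P x y 1).
  { unfold P in HP; rewrite !Rmult_1_l in HP; specialize (HP HS); lra. }
  rename x into x0; rename y into y0.
  apply (rectangle_induction l m P); [lra|lra| |].
  - intros x y t Ht H1 H2 H3 H4 Hx; unfold P in *.
    pose proof (Rmult_lt_0_compat _ _ Ht Hl); pose proof (Rmult_lt_0_compat _ _ Ht Hm).
    replace (2 * t * l) with (t * l + t * l) in * by ring.
    replace (2 * t * m) with (t * m + t * m) by ring.
    specialize (H1 ltac:(lra)); specialize (H2 ltac:(lra)).
    specialize (H3 ltac:(lra)); specialize (H4 ltac:(lra)).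
    rewrite circulation_split_l; [|intros; apply CU; lra|intros; apply CV; lra|lra|lra].
    rewrite !circulation_split_m; try lra;
      [|intros; apply CU; lra|intros; apply CV; lra|intros; apply CU; lra
       |intros; apply CV; lra].
    revert H1 H2 H3 H4; unfold Rabs; repeat destruct Rcase_abs; nra.
  - intros u v Hu Hv.
    destruct (HD u v ltac:(lra)) as (A & B & C & HU & HV).
    (* With tolerance [k] and [D = t * (l + m)], the two integrals below have total error
       [2 * k * D ^ 2], which is [e * t ^ 2] for this choice. *)
    assert (Hk : 0 < e / (2 * (l + m) ^ 2)).
    { apply Rdiv_lt_0_compat; [exact He|]; nra. }
    set (k := mkposreal _ Hk).
    destruct (HU k) as [d1 Hd1]; destruct (HV k) as [d2 Hd2].
    assert (Hd0 : 0 < Rmin (Rmin d1 d2) (S - u) / (l + m)).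
    { apply Rdiv_lt_0_compat; [|lra].
      repeat apply Rmin_glb_lt; try apply cond_pos; lra. }
    exists (Rmin (Rmin d1 d2) (S - u) / (l + m)); split; [exact Hd0|].
    intros x y t [Ht1 Ht2] Hxu Hyv HxS.
    pose proof (Rmult_lt_0_compat _ _ Ht1 Hl); pose proof (Rmult_lt_0_compat _ _ Ht1 Hm).
    assert (Ht : t * (l + m) < Rmin (Rmin d1 d2) (S - u)).
    { apply (Rmult_lt_compat_r (l + m)) in Ht2; [|lra].
      unfold Rdiv in Ht2; rewrite Rmult_assoc, Rinv_l in Ht2; lra. }
    pose proof (Rmin_l (Rmin d1 d2) (S - u)); pose proof (Rmin_l d1 d2).
    pose proof (Rmin_r d1 d2).
    set (D := t * (l + m)) in *.
    assert (HUr : forall s w, x <= s <= x + t * l -> y <= w <= y + t * m ->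
      Rabs (U s w - U u v - (A * (s - u) + B * (w - v))) <= k * D).
    { intros s w Hs Hw; assert (H4 : Rabs (s - u) <= D) by (apply Rabs_le; unfold D; lra).
      assert (H5 : Rabs (w - v) <= D) by (apply Rabs_le; unfold D; lra).
      eapply Rle_trans; [apply Hd1; lra|].
      apply Rmult_le_compat_l; [left; apply cond_pos|]; apply Rmax_lub; lra. }
    assert (HVr : forall s w, x <= s <= x + t * l -> y <= w <= y + t * m ->
      Rabs (V s w - V u v - (C * (s - u) + A * (w - v))) <= k * D).
    { intros s w Hs Hw; assert (H4 : Rabs (s - u) <= D) by (apply Rabs_le; unfold D; lra).
      assert (H5 : Rabs (w - v) <= D) by (apply Rabs_le; unfold D; lra).
      eapply Rle_trans; [apply Hd2; lra|].
      apply Rmult_le_compat_l; [left; apply cond_pos|]; apply Rmax_lub; lra. }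
    (* Between opposite sides the linear part of [U] grows by [A * (t * l)] and that of [V] by
       [A * (t * m)]. After integration both give [A * t ^ 2 * l * m], and they cancel in the
       circulation because the same [A] occurs in both. *)
    assert (IU : Rabs (RInt (fun w => U (x + t * l) w - U x w) y (y + t * m)
      - (y + t * m - y) * (A * (t * l))) <= (y + t * m - y) * (2 * (k * D))).
    { apply RInt_near_const; [lra| |].
      - apply (ex_RInt_continuous (V := R_CompleteNormedModule)); intros z _.
        apply (continuous_minus (U (x + t * l)) (U x)); apply CU; lra.
      - intros w Hw.
        pose proof (HUr (x + t * l) w ltac:(lra) Hw) as E1.
        pose proof (HUr x w ltac:(lra) Hw) as E2.
        apply Rabs_le; apply Rabs_le_between in E1, E2; lra. }
    assert (IV : Rabs (RInt (fun s => V s (y + t * m) - V s y) x (x + t * l)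
      - (x + t * l - x) * (A * (t * m))) <= (x + t * l - x) * (2 * (k * D))).
    { apply RInt_near_const; [lra| |].
      - apply (ex_RInt_continuous (V := R_CompleteNormedModule)).
        rewrite Rmin_left, Rmax_right by lra; intros z Hz.
        apply (continuous_minus (fun s => V s (y + t * m)) (fun s => V s y)); apply CV; lra.
      - intros s Hs.
        pose proof (HVr s (y + t * m) Hs ltac:(lra)) as E1.
        pose proof (HVr s y Hs ltac:(lra)) as E2.
        apply Rabs_le; apply Rabs_le_between in E1, E2; lra. }
    assert (EkD : e * t ^ 2 = D * (2 * (k * D))).
    { unfold k, D; simpl; field; lra. }
    rewrite EkD; unfold circulation.
    apply Rabs_le; apply Rabs_le_between in IU, IV.
    replace D with (t * l + t * m) at 1 3 by (unfold D; ring); lra. }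
destruct (Req_dec (circulation U V x y l m) 0) as [|Hne]; [assumption|exfalso].
pose proof (Rabs_pos_lt _ Hne).
specialize (Hall (Rabs (circulation U V x y l m) / 2)); lra.
Qed.

(** * Complex differentiability and circle means *)

(** The quotient-free form with [<=] admits [w = z] and reduces the rules below to estimates of
    moduli. *)
Definition cderiv (g : C -> C) (z l : C) : Prop :=
  forall e, 0 < e -> exists d, 0 < d /\ forall w, Cmod (w - z) < d ->
    Cmod (g w - g z - l * (w - z)) <= e * Cmod (w - z).

Definition ccont (g : C -> C) (z : C) : Prop :=
  forall e, 0 < e -> exists d, 0 < d /\ forall w, Cmod (w - z) < d ->
    Cmod (g w - g z) < e.

Lemma Rabs_Im_le (z : C) : Rabs (Im z) <= Cmod z.
Proof. eapply Rle_trans; [apply Rmax_r|apply Rmax_Cmod]. Qed.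

Lemma Cmod_le_2Rmax (z : C) : Cmod z <= 2 * Rmax (Rabs (Re z)) (Rabs (Im z)).
Proof.
eapply Rle_trans; [apply Cmod_2Rmax|].
apply Rmult_le_compat_r.
- eapply Rle_trans; [apply Rabs_pos|apply Rmax_l].
- assert (H := sqrt_le_1 2 (2 * 2) ltac:(lra) ltac:(lra) ltac:(lra)).
  rewrite sqrt_square in H; lra.
Qed.

Lemma cderiv_of_ex_derive (g : C -> C) (z : C) :
  @ex_derive C_AbsRing C_NormedModule g z -> exists l, cderiv g z l.
Proof.
intros [l [_ Hl]]; exists l; intros e He.
specialize (Hl z (fun P HP => HP) (mkposreal e He)).
destruct Hl as [d Hd]; exists d; split; [apply cond_pos|].
intros w Hw; specialize (Hd w Hw).
change (Cmod (g w - g z - (w - z) * l)%C <= e * Cmod (w - z)%C) in Hd.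
rewrite (Cmult_comm l); exact Hd.
Qed.

Lemma cderiv_ccont (g : C -> C) (z l : C) : cderiv g z l -> ccont g z.
Proof.
intros Hg e He; destruct (Hg 1 Rlt_0_1) as [d [Hd H]].
pose proof (Cmod_ge_0 l) as Hl.
assert (Hq : 0 < e / (Cmod l + 1)) by (apply Rdiv_lt_0_compat; lra).
exists (Rmin d (e / (Cmod l + 1))); split; [apply Rmin_glb_lt; assumption|].
intros w Hw.
assert (Hw1 : Cmod (w - z) < d) by (eapply Rlt_le_trans; [exact Hw|apply Rmin_l]).
assert (Hw2 : Cmod (w - z) < e / (Cmod l + 1))
  by (eapply Rlt_le_trans; [exact Hw|apply Rmin_r]).
specialize (H w Hw1).
apply (Rmult_lt_compat_l (Cmod l + 1)) in Hw2; [|lra].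
replace ((Cmod l + 1) * (e / (Cmod l + 1))) with e in Hw2 by (field; lra).
replace (g w - g z)%C with (g w - g z - l * (w - z) + l * (w - z))%C by ring.
eapply Rle_lt_trans; [apply Cmod_triangle|rewrite Cmod_mult; lra].
Qed.

Lemma cderiv_ext_loc (g h : C -> C) (z l : C) (d : R) :
  0 < d -> (forall w, Cmod (w - z) < d -> g w = h w) ->
  cderiv g z l -> cderiv h z l.
Proof.
intros Hd E Hg e He; destruct (Hg e He) as [d' [Hd' H]].
exists (Rmin d d'); split; [apply Rmin_glb_lt; assumption|].
intros w Hw; rewrite <- !E.
- apply H; eapply Rlt_le_trans; [exact Hw|apply Rmin_r].
- replace (z - z)%C with (RtoC 0) by ring; rewrite Cmod_0; exact Hd.
- eapply Rlt_le_trans; [exact Hw|apply Rmin_l].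
Qed.

Lemma cderiv_affine (a b z : C) : cderiv (fun w => a * w + b)%C z a.
Proof.
intros e He; exists 1; split; [lra|]; intros w _.
replace (a * w + b - (a * z + b) - a * (w - z))%C with (RtoC 0) by ring.
rewrite Cmod_0; apply Rmult_le_pos; [lra|apply Cmod_ge_0].
Qed.

Lemma cderiv_plus (g h : C -> C) (z l k : C) :
  cderiv g z l -> cderiv h z k -> cderiv (fun w => g w + h w)%C z (l + k).
Proof.
intros Hg Hh e He.
destruct (Hg (e / 2) ltac:(lra)) as [d [Hd H]].
destruct (Hh (e / 2) ltac:(lra)) as [d' [Hd' H']].
exists (Rmin d d'); split; [apply Rmin_glb_lt; assumption|]; intros w Hw.
specialize (H w (Rlt_le_trans _ _ _ Hw (Rmin_l _ _))).
specialize (H' w (Rlt_le_trans _ _ _ Hw (Rmin_r _ _))).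
replace (g w + h w - (g z + h z) - (l + k) * (w - z))%C with
  ((g w - g z - l * (w - z)) + (h w - h z - k * (w - z)))%C by ring.
eapply Rle_trans; [apply Cmod_triangle|lra].
Qed.

Lemma cderiv_mult (g h : C -> C) (z l k : C) :
  cderiv g z l -> cderiv h z k ->
  cderiv (fun w => g w * h w)%C z (l * h z + g z * k).
Proof.
intros Hg Hh e He.
pose proof (Cmod_ge_0 (h z)) as H1; pose proof (Cmod_ge_0 (g z)) as H2.
pose proof (Cmod_ge_0 l) as H3.
(* [M] dominates [Cmod (g z)], [Cmod l] and [Cmod (h z) + 1], the last being a bound for
   [Cmod (h w)] near [z]. Each of the three terms of the remainder then takes a third of [e]. *)
set (M := Cmod (h z) + Cmod (g z) + Cmod l + 1).
assert (HM : 0 < e / (3 * M)) by (apply Rdiv_lt_0_compat; unfold M; lra).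
destruct (Hg _ HM) as [d [Hd H]]; destruct (Hh _ HM) as [d' [Hd' H']].
destruct (cderiv_ccont _ _ _ Hh _ (Rmin_glb_lt _ _ _ HM Rlt_0_1)) as [d'' [Hd'' H'']].
exists (Rmin (Rmin d d') d''); split; [repeat apply Rmin_glb_lt; assumption|]; intros w Hw.
assert (Hw' := Rlt_le_trans _ _ _ Hw (Rmin_l _ _)).
specialize (H w (Rlt_le_trans _ _ _ Hw' (Rmin_l _ _))).
specialize (H' w (Rlt_le_trans _ _ _ Hw' (Rmin_r _ _))).
specialize (H'' w (Rlt_le_trans _ _ _ Hw (Rmin_r _ _))).
assert (H4 := Rlt_le_trans _ _ _ H'' (Rmin_l _ _)).
assert (H5 := Rlt_le_trans _ _ _ H'' (Rmin_r _ _)).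
replace (g w * h w - g z * h z - (l * h z + g z * k) * (w - z))%C with
  ((g w - g z - l * (w - z)) * (h z + (h w - h z)) +
   (g z * (h w - h z - k * (w - z)) + l * (w - z) * (h w - h z)))%C by ring.
pose proof (Cmod_ge_0 (w - z)) as H6.
set (D := Cmod (w - z)) in *; set (q := e / (3 * M)) in *.
assert (Eq : e = 3 * (q * M)) by (unfold q; field; unfold M; lra).
assert (T1 : Cmod ((g w - g z - l * (w - z)) * (h z + (h w - h z))) <= q * D * M).
{ rewrite Cmod_mult; apply Rmult_le_compat; [apply Cmod_ge_0|apply Cmod_ge_0|exact H|].
  eapply Rle_trans; [apply Cmod_triangle|unfold M; lra]. }
assert (T2 : Cmod (g z * (h w - h z - k * (w - z))) <= q * D * M).
{ rewrite Cmod_mult, Rmult_comm.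
  apply Rmult_le_compat; [apply Cmod_ge_0|apply Cmod_ge_0|exact H'|unfold M; lra]. }
assert (T3 : Cmod (l * (w - z) * (h w - h z)) <= q * D * M).
{ rewrite !Cmod_mult; fold D.
  replace (q * D * M) with (M * D * q) by ring.
  apply Rmult_le_compat; [apply Rmult_le_pos; assumption|apply Cmod_ge_0| |lra].
  apply Rmult_le_compat_r; [assumption|unfold M; lra]. }
eapply Rle_trans; [apply Cmod_triangle|].
assert (T4 := Cmod_triangle (g z * (h w - h z - k * (w - z))) (l * (w - z) * (h w - h z))).
rewrite Eq; lra.
Qed.

Lemma cderiv_inv (h : C -> C) (z k : C) :
  cderiv h z k -> h z <> 0%C ->
  cderiv (fun w => / h w)%C z (- k / (h z * h z)).
Proof.
intros Hh Hz e He.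
assert (Ha : 0 < Cmod (h z)) by (apply Cmod_gt_0; exact Hz).
set (a := Cmod (h z)) in *.
assert (Ha2 : 0 < a / 2) by lra.
pose proof (Cmod_ge_0 k) as Hk.
(* The two tolerances bound each term of the numerator below by [e * a ^ 3 / 4] times
   [Cmod (w - z)], while [a / 2 < Cmod (h w)] keeps the modulus of the denominator above
   [a ^ 3 / 2]. *)
assert (Hq1 : 0 < e * a ^ 2 / 4).
{ apply Rdiv_lt_0_compat; [|lra]; apply Rmult_lt_0_compat; [lra|apply pow_lt, Ha]. }
assert (Hq2 : 0 < e * a ^ 3 / (4 * (Cmod k + 1))).
{ apply Rdiv_lt_0_compat; [|lra]; apply Rmult_lt_0_compat; [lra|apply pow_lt, Ha]. }
destruct (Hh _ Hq1) as [d [Hd H]].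
destruct (cderiv_ccont _ _ _ Hh _
  (Rmin_glb_lt _ _ _ Ha2 Hq2)) as [d' [Hd' H']].
exists (Rmin d d'); split; [apply Rmin_glb_lt; assumption|]; intros w Hw.
specialize (H w (Rlt_le_trans _ _ _ Hw (Rmin_l _ _))).
specialize (H' w (Rlt_le_trans _ _ _ Hw (Rmin_r _ _))).
assert (H1 := Rlt_le_trans _ _ _ H' (Rmin_l _ _)).
assert (H2 := Rlt_le_trans _ _ _ H' (Rmin_r _ _)).
assert (Hb : a / 2 < Cmod (h w)).
{ assert (T := Cmod_triangle (h w) (- (h w - h z))).
  replace (h w + - (h w - h z))%C with (h z) in T by ring.
  rewrite Cmod_opp in T; fold a in T; lra. }
assert (Hw0 : h w <> 0%C) by (apply Cmod_gt_0; lra).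
replace (/ h w - / h z - - k / (h z * h z) * (w - z))%C with
  ((- (h z * (h w - h z - k * (w - z))) + k * (w - z) * (h w - h z)) *
   / (h w * h z * h z))%C by (field; split; assumption).
rewrite Cmod_mult, Cmod_inv by (repeat apply Cmult_neq_0; assumption).
rewrite !Cmod_mult; fold a.
pose proof (Cmod_ge_0 (w - z)) as H6.
set (D := Cmod (w - z)) in *; set (b := Cmod (h w)) in *.
assert (N : Cmod (- (h z * (h w - h z - k * (w - z))) + k * (w - z) * (h w - h z))
  <= e * D * (a ^ 3 / 2)).
{ eapply Rle_trans; [apply Cmod_triangle|].
  rewrite Cmod_opp, !Cmod_mult; fold a; fold D.
  assert (T1 := Rmult_le_compat_l a _ _ (Rlt_le _ _ Ha) H).
  assert (T2 : Cmod k * D * Cmod (h w - h z) <= D * (e * a ^ 3 / 4)).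
  { replace (D * (e * a ^ 3 / 4)) with
      ((Cmod k + 1) * D * (e * a ^ 3 / (4 * (Cmod k + 1)))) by (field; lra).
    apply Rmult_le_compat; [apply Rmult_le_pos; assumption|apply Cmod_ge_0| |lra].
    apply Rmult_le_compat_r; lra. }
  replace (a * (e * a ^ 2 / 4 * D)) with (D * (e * a ^ 3 / 4)) in T1 by field.
  lra. }
assert (Hc : 0 < b * a * a) by (repeat apply Rmult_lt_0_compat; lra).
apply (Rmult_le_reg_r (b * a * a)); [exact Hc|].
rewrite Rmult_assoc, Rinv_l, Rmult_1_r by lra.
eapply Rle_trans; [exact N|].
apply Rmult_le_compat_l; [apply Rmult_le_pos; lra|].
replace (a ^ 3 / 2) with (a / 2 * (a * a)) by field.
rewrite Rmult_assoc; apply Rmult_le_compat_r; nra.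
Qed.

(** * Cauchy-Riemann equations, logarithmic polar coordinates and circle means *)

Lemma cderiv_Re_Im (g : C -> C) (x y : R) (l : C) :
  cderiv g (x, y) l ->
  differentiable_pt_lim (fun a b => Re (g (a, b))) x y (Re l) (- Im l) /\
  differentiable_pt_lim (fun a b => Im (g (a, b))) x y (Im l) (Re l).
Proof.
intros Hg.
assert (Hloc : forall e : posreal, locally_2d (fun a b =>
  Cmod (g (a, b) - g (x, y) - l * ((a, b) - (x, y))) <=
  e * Rmax (Rabs (a - x)) (Rabs (b - y))) x y).
(* Halving [e], and [d] below, absorbs the factor 2 between the modulus and the maximum of the
   coordinates. *)
{ intros e; destruct (Hg (e / 2)) as [d [Hd H]].
  { pose proof (cond_pos e); lra. }
  assert (Hd2 : 0 < d / 2) by lra; exists (mkposreal _ Hd2); simpl.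
  intros a b Ha Hb.
  assert (T := Cmod_le_2Rmax ((a, b) - (x, y))).
  change (Re ((a, b) - (x, y))) with (a - x) in T.
  change (Im ((a, b) - (x, y))) with (b - y) in T.
  pose proof (Rmax_lub_lt _ _ _ Ha Hb).
  specialize (H (a, b) ltac:(lra)).
  eapply Rle_trans; [exact H|].
  apply (Rmult_le_compat_l (e / 2)) in T; [|pose proof (cond_pos e); lra].
  lra. }
split; intros e; destruct (Hloc e) as [d Hd]; exists d; intros a b Ha Hb;
  (eapply Rle_trans; [|apply Hd; assumption]).
- eapply Rle_trans; [|apply re_le_Cmod].
  apply Req_le; f_equal; unfold Cminus, Cmult, Cplus, Copp, Re, Im; simpl; ring.
- eapply Rle_trans; [|apply Rabs_Im_le].
  apply Req_le; f_equal; unfold Cminus, Cmult, Cplus, Copp, Re, Im; simpl; ring.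
Qed.

Lemma differentiable_affine_product (X x y : R) :
  differentiable_pt_lim (fun a b => X + a * b) x y y x.
Proof.
intros e; exists e; intros u v Hu Hv.
replace (X + u * v - (X + x * y) - (y * (u - x) + x * (v - y)))
  with ((u - x) * (v - y)) by ring.
rewrite Rabs_mult; apply Rmult_le_compat; [apply Rabs_pos|apply Rabs_pos| |apply Rmax_r].
lra.
Qed.

Lemma differentiable_polar (X s t : R) (f : R -> R) (f' : R) :
  derivable_pt_lim f t f' ->
  differentiable_pt_lim (fun s t => X + exp s * f t) s t (exp s * f t) (exp s * f').
Proof.
intros Hf.
assert (H := differentiable_pt_lim_comp (fun a b => X + a * b)
  (fun s _ => exp s) (fun _ t => f t) s t _ _ _ _ _ _
  (differentiable_affine_product X (exp s) (f t))
  (differentiable_pt_lim_proj1_0 _ s t _ (derivable_pt_lim_exp s))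
  (differentiable_swap _ _ _ _ _ (differentiable_pt_lim_proj1_0 _ t s _ Hf))).
replace (exp s * f t) with (f t * exp s + exp s * 0) by ring.
replace (exp s * f') with (f t * 0 + exp s * f') by ring.
exact H.
Qed.

Definition polar (c : C) (r t : R) : C := (Re c + r * cos t, Im c + r * sin t).

Lemma Cmod_polar (c : C) (r t : R) : 0 <= r -> Cmod (polar c r t - c) = r.
Proof.
intros Hr; unfold Cmod.
replace (fst (polar c r t - c)%C ^ 2 + snd (polar c r t - c)%C ^ 2) with (r ^ 2);
  [apply sqrt_pow2, Hr|].
replace (r ^ 2) with (r ^ 2 * ((sin t)² + (cos t)²)) by (rewrite sin2_cos2; ring).
unfold polar, Rsqr, Re, Im; simpl; ring.
Qed.

(** The map from [s + i t] to [c + exp (s + i t)] is holomorphic, so the Cauchy-Riemann equations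
    hold in [(s, t)] too. The repeated [A] is one of them, and is the closedness condition of
    [circulation_closed]. *)
Lemma cderiv_polar (g : C -> C) (c : C) (s t : R) (l : C) :
  cderiv g (polar c (exp s) t) l ->
  exists A B C,
    differentiable_pt_lim (fun s t => Re (g (polar c (exp s) t))) s t A B /\
    differentiable_pt_lim (fun s t => Im (g (polar c (exp s) t))) s t C A.
Proof.
intros Hg; apply cderiv_Re_Im in Hg; destruct Hg as [H1 H2].
assert (Hc := differentiable_polar (Re c) s t cos _ (derivable_pt_lim_cos t)).
assert (Hs := differentiable_polar (Im c) s t sin _ (derivable_pt_lim_sin t)).
assert (F1 := differentiable_pt_lim_comp _ _ _ _ _ _ _ _ _ _ _ H1 Hc Hs).
assert (F2 := differentiable_pt_lim_comp _ _ _ _ _ _ _ _ _ _ _ H2 Hc Hs).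
do 3 eexists; split; [exact F1|].
match type of F2 with differentiable_pt_lim _ _ _ _ ?b =>
  match goal with |- differentiable_pt_lim _ _ _ _ ?b' => replace b' with b by ring end end.
exact F2.
Qed.

(* With [z = c + exp (s + i t)], the imaginary part of [g dz / (z - c)] is a
   closed form in [(s, t)] whose circulation around [a, b] x [0, 2 pi] is the
   difference of two circle means; then let [a] tend to minus infinity. *)
Lemma circle_mean (g : C -> C) (c : C) (R0 : R) :
  (forall z, 0 < Cmod (z - c) < R0 -> exists l, cderiv g z l) ->
  ccont g c ->
  forall r, 0 < r < R0 ->
  ex_RInt (fun t => Re (g (polar c r t))) 0 (2 * PI) /\
  RInt (fun t => Re (g (polar c r t))) 0 (2 * PI) = 2 * PI * Re (g c).
Proof.
intros Hg Hc r Hr.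
pose proof PI_RGT_0 as Hpi.
set (U := fun s t => Re (g (polar c (exp s) t))).
set (V := fun s t => Im (g (polar c (exp s) t))).
assert (HD : forall s t, s < ln R0 -> exists A B C,
  differentiable_pt_lim U s t A B /\ differentiable_pt_lim V s t C A).
{ intros s t Hs.
  assert (Hs' : exp s < R0) by (rewrite <- (exp_ln R0) by lra; apply exp_increasing, Hs).
  pose proof (exp_pos s).
  destruct (Hg (polar c (exp s) t)) as [l Hl].
  { rewrite Cmod_polar; lra. }
  exact (cderiv_polar g c s t l Hl). }
assert (HI : forall s, s < ln R0 -> ex_RInt (U s) 0 (2 * PI)).
{ intros s Hs; apply (ex_RInt_continuous (V := R_CompleteNormedModule)).
  intros t _; destruct (HD s t Hs) as (A & B & C & H & _).
  exact (differentiable_continuous_r _ _ _ _ _ H). }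
assert (Hlr : ln r < ln R0) by (apply ln_increasing; lra).
assert (Er : forall t, U (ln r) t = Re (g (polar c r t))).
{ intros t; unfold U; rewrite exp_ln by lra; reflexivity. }
(* The circle means at radii [exp a] and [r] agree: the sides [t = 0] and [t = 2 * PI] have the same
   image in the plane and cancel, leaving the two circles. *)
assert (Hconst : forall a, a < ln r -> RInt (U (ln r)) 0 (2 * PI) = RInt (U a) 0 (2 * PI)).
{ intros a Ha.
  assert (H := circulation_closed U V (ln R0) HD a 0 (ln r - a) (2 * PI)
    ltac:(lra) ltac:(lra) ltac:(lra)).
  unfold circulation in H; rewrite Rplus_0_l in H.
  replace (a + (ln r - a)) with (ln r) in H by ring.
  rewrite (RInt_ext (fun s => V s (2 * PI) - V s 0) (fun _ => 0)) in H.
  2: { intros s _; apply Rminus_diag_eq; unfold V, polar.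
       rewrite cos_2PI, sin_2PI, cos_0, sin_0; reflexivity. }
  rewrite RInt_const in H; unfold scal in H; simpl in H; unfold mult in H; simpl in H.
  rewrite (RInt_minus (V := R_CompleteNormedModule) (U (ln r)) (U a)) in H
    by (apply HI; lra).
  unfold minus, plus, opp in H; simpl in H; lra. }
split; [apply (ex_RInt_ext (U (ln r))); [intros t _; apply Er|apply HI, Hlr]|].
rewrite <- (RInt_ext (U (ln r))) by (intros t _; apply Er).
apply cond_eq; intros e He.
(* On a circle of radius [exp a < d] the integrand is within [e / (4 * PI)] of [Re (g c)], so the
   integral is within [e / 2] of its claimed value. *)
destruct (Hc (e / (4 * PI))) as [d [Hd H]]; [apply Rdiv_lt_0_compat; lra|].
pose proof (Rmin_l (ln d) (ln r)); pose proof (Rmin_r (ln d) (ln r)).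
set (a := Rmin (ln d) (ln r) - 1).
assert (Had : exp a < d).
{ rewrite <- (exp_ln d) by lra; apply exp_increasing; unfold a; lra. }
rewrite (Hconst a) by (unfold a; lra).
assert (B : Rabs (RInt (U a) 0 (2 * PI) - (2 * PI - 0) * Re (g c))
  <= (2 * PI - 0) * (e / (4 * PI))).
{ apply RInt_near_const; [lra|apply HI; unfold a; lra|].
  intros t _; left; unfold U.
  eapply Rle_lt_trans; [|apply (H (polar c (exp a) t)); rewrite Cmod_polar;
    [exact Had|left; apply exp_pos]].
  apply (re_le_Cmod (g (polar c (exp a) t) - g c)). }
rewrite Rminus_0_r in B.
replace (2 * PI * (e / (4 * PI))) with (e / 2) in B by (field; lra).
lra.
Qed.

(** * Maximum principle, Schwarz's lemma and Harnack's inequality *)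

(** Such a drop would put the mean over the circle below the value at the centre, against
    [circle_mean]. *)
Lemma circle_no_strict_drop (g : C -> C) (c : C) (R0 r e : R) :
  (forall z, 0 < Cmod (z - c) < R0 -> exists l, cderiv g z l) ->
  ccont g c -> 0 < r < R0 -> 0 < e ->
  ~ (forall z, Cmod (z - c) = r -> Re (g z) <= Re (g c) - e).
Proof.
intros Hg Hc Hr He Hdrop.
destruct (circle_mean g c R0 Hg Hc r Hr) as [HI HE].
pose proof PI_RGT_0 as Hpi.
assert (H : RInt (fun t => Re (g (polar c r t))) 0 (2 * PI) <=
  RInt (fun _ => Re (g c) - e) 0 (2 * PI)).
{ apply RInt_le; [lra|exact HI|apply ex_RInt_const|].
  intros t _; apply Hdrop, Cmod_polar; lra. }
rewrite RInt_const, HE in H; unfold scal in H; simpl in H; unfold mult in H; simpl in H.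
nra.
Qed.

(** Upper semicontinuity suffices on a compact disk. The bisection runs over squares, and [P] asks
    for a point of the disk that dominates [N] on the part of the square inside the disk; this point
    may lie outside the square, so the best of four candidates serves their union. *)
Lemma exists_max_disk (N : C -> R) (rho : R) :
  0 < rho ->
  (forall z, Cmod z <= rho -> forall v, N z < v ->
     exists d, 0 < d /\ forall w, Cmod (w - z) < d -> N w < v) ->
  exists k, Cmod k <= rho /\ forall z, Cmod z <= rho -> N z <= N k.
Proof.
intros Hrho HN.
pose (P := fun x y t => exists k, Cmod k <= rho /\
  forall z, x <= Re z <= x + t * (2 * rho) -> y <= Im z <= y + t * (2 * rho) ->
    Cmod z <= rho -> N z <= N k).
enough (HP : P (- rho) (- rho) 1).
{ destruct HP as [k [Hk H]]; exists k; split; [exact Hk|]; intros z Hz.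
  pose proof (re_le_Cmod z) as H1; pose proof (Rabs_Im_le z) as H2.
  assert (H1' := Rle_trans _ _ _ H1 Hz); assert (H2' := Rle_trans _ _ _ H2 Hz).
  apply Rabs_le_between in H1', H2'; apply H; lra. }
apply (rectangle_induction (2 * rho) (2 * rho) P); [lra|lra| |].
- intros x y t Ht (k1 & K1 & H1) (k2 & K2 & H2) (k3 & K3 & H3) (k4 & K4 & H4).
  assert (Hmax : forall k k', Cmod k <= rho -> Cmod k' <= rho ->
    exists k'', Cmod k'' <= rho /\ N k <= N k'' /\ N k' <= N k'').
  { intros k k' Hk Hk'; destruct (Rle_lt_dec (N k) (N k')).
    - exists k'; repeat split; [assumption|assumption|lra].
    - exists k; repeat split; [assumption|lra|lra]. }
  destruct (Hmax k1 k2 K1 K2) as (k & K & L1 & L2).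
  destruct (Hmax k3 k4 K3 K4) as (k' & K' & L3 & L4).
  destruct (Hmax k k' K K') as (k'' & K'' & L5 & L6).
  exists k''; split; [exact K''|]; intros z Hx Hy Hz.
  destruct (Rle_lt_dec (Re z) (x + t * (2 * rho))) as [Hx'|Hx'];
  destruct (Rle_lt_dec (Im z) (y + t * (2 * rho))) as [Hy'|Hy'].
  + specialize (H1 z ltac:(lra) ltac:(lra) Hz); lra.
  + specialize (H3 z ltac:(lra) ltac:(lra) Hz); lra.
  + specialize (H2 z ltac:(lra) ltac:(lra) Hz); lra.
  + specialize (H4 z ltac:(lra) ltac:(lra) Hz); lra.
- intros u v _ _; set (p := (u, v) : C).
  assert (Hlocal : forall k d, Cmod k <= rho -> 0 < d ->
    (forall z, Cmod (z - p) < d -> Cmod z <= rho -> N z <= N k) ->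
    exists d, 0 < d /\ forall x y t, 0 < t < d ->
      x <= u <= x + t * (2 * rho) -> y <= v <= y + t * (2 * rho) -> P x y t).
  (* A square of side [2 * rho * t] has all its points within [4 * rho * t] of [p]. *)
  { intros k d Hk Hd H; exists (d / (4 * rho)); split; [apply Rdiv_lt_0_compat; lra|].
    intros x y t Ht Hx Hy; exists k; split; [exact Hk|].
    intros z Hzx Hzy Hz; apply H; [|exact Hz].
    eapply Rle_lt_trans; [apply Cmod_le_2Rmax|].
    assert (Hd' : 2 * (t * (2 * rho)) < d).
    { replace d with (2 * (d / (4 * rho) * (2 * rho))) by (field; lra).
      apply Rmult_lt_compat_l; [lra|]; apply Rmult_lt_compat_r; lra. }
    eapply Rle_lt_trans; [|exact Hd'].
    apply Rmult_le_compat_l; [lra|].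
    change (Re (z - p)) with (Re z - u); change (Im (z - p)) with (Im z - v).
    apply Rmax_lub; apply Rabs_le; lra. }
  (* Three cases: a point of the disk beats [p] strictly, hence also beats all points near [p]; [p]
     is itself a maximum; or [p] lies outside the disk, and small squares around it miss the
     disk. *)
  destruct (Rle_lt_dec (Cmod p) rho) as [Hp|Hp].
  + destruct (classic (exists k, Cmod k <= rho /\ N p < N k)) as [[k [Hk Hpk]]|Hno].
    * destruct (HN p Hp _ Hpk) as [d [Hd H]].
      apply (Hlocal k d Hk Hd); intros z Hz _; left; auto.
    * apply (Hlocal p 1 Hp Rlt_0_1); intros z _ Hz.
      apply Rnot_lt_le; intros Hlt; apply Hno; exists z; split; assumption.
  + apply (Hlocal (RtoC 0) (Cmod p - rho)); [rewrite Cmod_0; lra|lra|].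
    intros z Hzp Hz; exfalso.
    assert (T := Cmod_triangle z (- (z - p))); rewrite Cmod_opp in T.
    replace (z + - (z - p))%C with p in T by ring; lra.
Qed.

Lemma exists_phase (a : C) : exists q : C, Cmod q = 1 /\ (q * a)%C = RtoC (Cmod a).
Proof.
destruct (Ceq_dec a 0) as [->|Ha].
- exists (RtoC 1); rewrite Cmod_1, Cmod_0; split; [reflexivity|ring].
- assert (H := proj1 (Cmod_gt_0 a) Ha).
  assert (H' : RtoC (Cmod a) <> 0%C) by (intros E; apply RtoC_inj in E; lra).
  exists (Cconj a / Cmod a)%C; split.
  + rewrite Cmod_div, Cmod_conj, Cmod_R, Rabs_pos_eq by (assumption || lra); field; lra.
  + replace (Cconj a / Cmod a * a)%C with (a * Cconj a / Cmod a)%C by (field; exact H').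
    rewrite <- Cmod2_conj; rewrite RtoC_pow; simpl; field; exact H'.
Qed.

(* At an interior maximum [z0] of [|g z| + eta |z|^2], the function
   [q g z + 2 eta conj z0 (z - z0)] with a suitable phase [q] would violate
   the mean value property. *)
Lemma max_modulus (g : C -> C) (R0 rho B : R) :
  0 < rho < R0 ->
  (forall z, 0 < Cmod z < R0 -> exists l, cderiv g z l) ->
  ccont g 0 ->
  (forall z, Cmod z = rho -> Cmod (g z) <= B) ->
  forall u, Cmod u <= rho -> Cmod (g u) <= B.
Proof.
intros Hrho Hg Hg0 HB u Hu.
apply Rnot_lt_le; intros Hlt.
assert (HB0 : 0 <= B).
{ eapply Rle_trans; [apply Cmod_ge_0|apply (HB (RtoC rho))].
  rewrite Cmod_R; apply Rabs_pos_eq; lra. }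
assert (Hcont : forall z, Cmod z <= rho -> ccont g z).
{ intros z Hz; destruct (Ceq_dec z 0) as [->|Hz0]; [exact Hg0|].
  destruct (Hg z) as [l Hl]; [split; [apply Cmod_gt_0, Hz0|lra]|].
  exact (cderiv_ccont _ _ _ Hl). }
(* The penalty on the boundary is half the excess of [Cmod (g u)] over [B], so boundary values stay
   below the value at [u] and the maximum is interior. *)
set (eta := (Cmod (g u) - B) / (2 * rho ^ 2)).
assert (Hr2 : 0 < rho ^ 2) by (apply pow_lt; lra).
assert (Heta : 0 < eta) by (apply Rdiv_lt_0_compat; lra).
assert (Heta' : B + eta * rho ^ 2 < Cmod (g u)).
{ replace (eta * rho ^ 2) with ((Cmod (g u) - B) / 2) by (unfold eta; field; lra); lra. }
destruct (exists_max_disk (fun z => Cmod (g z) + eta * Cmod z ^ 2) rho) as [z0 [Hz0 Hmax]].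
{ lra. }
{ intros z Hz v Hv.
  set (h := v - (Cmod (g z) + eta * Cmod z ^ 2)).
  assert (Hh : 0 < h) by (unfold h; lra).
  pose proof (Cmod_ge_0 z) as Hz'.
  destruct (Hcont z Hz (h / 2) ltac:(lra)) as [d [Hd H]].
  assert (Hd2 : 0 < h / (2 * eta * (2 * Cmod z + 1))).
  { apply Rdiv_lt_0_compat; [lra|]; apply Rmult_lt_0_compat; lra. }
  (* For [Cmod (w - z) < 1] the square of the modulus grows by at most
     [Cmod (w - z) * (2 * Cmod z + 1)]; the last radius keeps [eta] times this below [h / 2]. *)
  exists (Rmin d (Rmin 1 (h / (2 * eta * (2 * Cmod z + 1))))).
  split; [repeat apply Rmin_glb_lt; lra|]; intros w Hw.
  specialize (H w (Rlt_le_trans _ _ _ Hw (Rmin_l _ _))).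
  assert (Hw' := Rlt_le_trans _ _ _ Hw (Rmin_r _ _)).
  assert (Hw1 := Rlt_le_trans _ _ _ Hw' (Rmin_l _ _)).
  assert (Hw2 := Rlt_le_trans _ _ _ Hw' (Rmin_r _ _)).
  assert (T1 := Cmod_triangle (g z) (g w - g z)).
  replace (g z + (g w - g z))%C with (g w) in T1 by ring.
  assert (T2 := Cmod_triangle z (w - z)).
  replace (z + (w - z))%C with w in T2 by ring.
  pose proof (Cmod_ge_0 (w - z)) as Hwz; pose proof (Cmod_ge_0 w) as Hw0.
  assert (T3 : Cmod w ^ 2 <= (Cmod z + Cmod (w - z)) ^ 2) by (apply pow_incr; lra).
  assert (T4 : eta * (Cmod (w - z) * (2 * Cmod z + 1)) < h / 2).
  { apply (Rmult_lt_compat_l (eta * (2 * Cmod z + 1))) in Hw2;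
      [|apply Rmult_lt_0_compat; lra].
    replace (eta * (2 * Cmod z + 1) * (h / (2 * eta * (2 * Cmod z + 1))))
      with (h / 2) in Hw2 by (field; lra).
    lra. }
  assert (T5 : eta * Cmod w ^ 2 <= eta * (Cmod z ^ 2 + Cmod (w - z) * (2 * Cmod z + 1))).
  { apply Rmult_le_compat_l; [lra|]; nra. }
  unfold h in *; lra. }
assert (HN0 := Hmax u Hu); simpl in HN0.
pose proof (Cmod_ge_0 z0) as Hz0'.
assert (Hu2 : 0 <= eta * Cmod u ^ 2).
{ apply Rmult_le_pos; [lra|]; apply pow_le, Cmod_ge_0. }
simpl in Hu2.
assert (Hint : Cmod z0 < rho).
{ destruct Hz0 as [|E]; [assumption|]; exfalso.
  specialize (HB z0 E); rewrite E in HN0; simpl in Heta'; lra. }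
(* The punctured disk around [z0] must avoid the origin, where only continuity of [g] is assumed. If
   [z0 = 0] the puncture does this; otherwise the radius is at most [Cmod z0]. *)
assert (Hloc : exists r R1, 0 < r < R1 /\ r + Cmod z0 <= rho /\
  forall z, 0 < Cmod (z - z0) < R1 -> 0 < Cmod z < R0).
{ assert (T : forall z, Cmod z <= Cmod z0 + Cmod (z - z0)).
  { intros z; replace z with (z0 + (z - z0))%C at 1 by ring; apply Cmod_triangle. }
  destruct (Ceq_dec z0 0) as [->|Hne].
  - exists (rho / 2), rho; rewrite Cmod_0 in *; split; [lra|split; [lra|]].
    intros z Hz; replace (z - 0)%C with z in Hz by ring; lra.
  - assert (H := proj1 (Cmod_gt_0 z0) Hne).
    pose proof (Rmin_l (Cmod z0) (rho - Cmod z0)).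
    pose proof (Rmin_r (Cmod z0) (rho - Cmod z0)).
    assert (0 < Rmin (Cmod z0) (rho - Cmod z0)) by (apply Rmin_glb_lt; lra).
    exists (Rmin (Cmod z0) (rho - Cmod z0) / 2), (Rmin (Cmod z0) (rho - Cmod z0)).
    split; [lra|split; [lra|]]; intros z Hz; specialize (T z).
    assert (T' := Cmod_triangle z (- (z - z0))); rewrite Cmod_opp in T'.
    replace (z + - (z - z0))%C with z0 in T' by ring; lra. }
destruct Hloc as (r & R1 & Hr & Hrr & HR1).
destruct (exists_phase (g z0)) as [q [Hq1 Hq2]].
set (b := (RtoC (2 * eta) * Cconj z0)%C).
set (k := fun z => (q * g z + 0 + (b * z + - (b * z0)))%C).
assert (Hk : forall z l, cderiv g z l -> exists l', cderiv k z l').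
{ intros z l Hl; eexists; unfold k; apply cderiv_plus; [|apply cderiv_affine].
  apply cderiv_plus.
  - apply (cderiv_mult (fun _ => q) g z 0 l); [|exact Hl].
    apply (cderiv_ext_loc (fun w => 0 * w + q)%C _ z 0 1); [lra| |apply cderiv_affine].
    intros w _; ring.
  - apply (cderiv_ext_loc (fun w => 0 * w + 0)%C _ z 0 1); [lra| |apply cderiv_affine].
    intros w _; ring. }
assert (Hkc : ccont k z0).
{ destruct (Ceq_dec z0 0) as [E|Hne].
  - intros e He; destruct (Hg0 e He) as [d [Hd H]]; exists d; split; [exact Hd|].
    intros w Hw; rewrite E in Hw.
    (* At [z0 = 0] the linear term vanishes, and continuity of [k] reduces to that of [g]. *)
    assert (Eb : b = RtoC 0).
    { unfold b; rewrite E; unfold Cconj, RtoC, Cmult; simpl.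
      apply injective_projections; simpl; ring. }
    replace (k w - k z0)%C with (q * (g w - g 0))%C by (unfold k; rewrite Eb, E; ring).
    rewrite Cmod_mult, Hq1, Rmult_1_l; apply H, Hw.
  - destruct (Hg z0) as [l Hl]; [split; [apply Cmod_gt_0, Hne|lra]|].
    destruct (Hk z0 l Hl) as [l' Hl']; exact (cderiv_ccont _ _ _ Hl'). }
apply (circle_no_strict_drop k z0 R1 r (eta * r ^ 2)); [|exact Hkc|exact Hr| |].
- intros z Hz; destruct (Hg z (HR1 z Hz)) as [l Hl]; exact (Hk z l Hl).
- apply Rmult_lt_0_compat; [lra|apply pow_lt; lra].
- intros z Hz.
  assert (Hzrho : Cmod z <= rho).
  { replace z with (z0 + (z - z0))%C by ring; eapply Rle_trans; [apply Cmod_triangle|lra]. }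
  specialize (Hmax z Hzrho).
  assert (Ek0 : Re (k z0) = Cmod (g z0)).
  { replace (k z0) with (q * g z0)%C by (unfold k; ring); rewrite Hq2; reflexivity. }
  assert (Ek : Re (k z) <= Cmod (g z) + Re (b * (z - z0))).
  { replace (k z) with (q * g z + b * (z - z0))%C by (unfold k; ring).
    change (Re (q * g z + b * (z - z0))) with (Re (q * g z) + Re (b * (z - z0))).
    assert (H := re_le_Cmod (q * g z)); rewrite Cmod_mult, Hq1, Rmult_1_l in H.
    apply Rabs_le_between in H; lra. }
  (* Expansion of [Cmod z ^ 2] about [z0] on the circle of radius [r]. With the maximality of [z0]
     it makes [Re (k z)] at most [Re (k z0) - eta * r ^ 2]. *)
  assert (E2 : Re (b * (z - z0)) = eta * (Cmod z ^ 2 - Cmod z0 ^ 2 - r ^ 2)).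
  { rewrite <- Hz, !Cmod2_alt; unfold b, Cconj, Re, Im; simpl; ring. }
  rewrite Ek0; lra.
Qed.

(** The quotient [w z / z], completed by the derivative of [w] at 0, is continuous there and bounded
    by [/ rho] on the circle of radius [rho]; [max_modulus] carries the bound to [u], and [rho] is
    then taken close to 1. *)
Lemma schwarz (w : C -> C) :
  (forall z, Cmod z < 1 -> exists l, cderiv w z l) ->
  w 0 = 0%C ->
  (forall z, Cmod z < 1 -> Cmod (w z) <= 1) ->
  forall u, Cmod u < 1 -> Cmod (w u) <= Cmod u.
Proof.
intros Hd H0 H1 u Hu.
destruct (Ceq_dec u 0) as [->|Hune]; [rewrite H0, Cmod_0; lra|].
assert (Hu0 := proj1 (Cmod_gt_0 u) Hune).
destruct (Hd 0%C) as [l0 Hl0]; [rewrite Cmod_0; lra|].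
set (g := fun z => if Ceq_dec z 0 then l0 else (w z * / z)%C).
assert (Eg : forall z : C, z <> 0%C -> g z = (w z * / z)%C).
{ intros z Hz; unfold g; destruct (Ceq_dec z 0) as [E|_]; [elim Hz; exact E|reflexivity]. }
assert (Hcg : ccont g 0).
{ intros e He; destruct (Hl0 (e / 2) ltac:(lra)) as [d [Hdp H]]; exists d; split; [exact Hdp|].
  intros z Hz; specialize (H z Hz).
  assert (Eg0 : g 0%C = l0).
  { unfold g; destruct (Ceq_dec 0%C 0%C) as [_|n]; [reflexivity|elim n; reflexivity]. }
  rewrite Eg0; destruct (Ceq_dec z 0) as [->|Hz0].
  - rewrite Eg0; replace (l0 - l0)%C with (RtoC 0) by ring; rewrite Cmod_0; lra.
  - assert (Hzp := proj1 (Cmod_gt_0 z) Hz0).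
    rewrite Eg by assumption.
    replace (w z * / z - l0)%C with ((w z - w 0 - l0 * (z - 0)) * / z)%C
      by (rewrite H0; field; exact Hz0).
    replace (z - 0)%C with z in * by ring.
    rewrite Cmod_mult, Cmod_inv by exact Hz0.
    apply (Rmult_lt_reg_r (Cmod z)); [exact Hzp|].
    rewrite Rmult_assoc, Rinv_l, Rmult_1_r by lra.
    apply Rle_lt_trans with (1 := H); nra. }
assert (Hdg : forall z, 0 < Cmod z < 1 -> exists l, cderiv g z l).
{ intros z Hz; destruct (Hd z) as [l Hl]; [lra|].
  assert (Hzne : z <> 0%C) by (apply Cmod_gt_0; lra).
  eexists; apply (cderiv_ext_loc (fun z => w z * / z)%C _ z _ (Cmod z)); [lra| |].
  - intros v Hv; symmetry; apply Eg; intros ->.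
    replace (0 - z)%C with (- z)%C in Hv by ring; rewrite Cmod_opp in Hv; lra.
  - apply cderiv_mult; [exact Hl|].
    apply (cderiv_inv (fun z => z) z 1); [|exact Hzne].
    apply (cderiv_ext_loc (fun z => 1 * z + 0)%C _ z 1 1); [lra| |apply cderiv_affine].
    intros v _; ring. }
assert (Hrho : forall rho, Cmod u <= rho < 1 -> Cmod (w u) * rho <= Cmod u).
{ intros rho Hr.
  assert (H : Cmod (g u) <= / rho).
  { apply (max_modulus g 1 rho (/ rho)); [lra|exact Hdg|exact Hcg| |lra].
    intros z Hz; assert (Hzne : z <> 0%C) by (apply Cmod_gt_0; lra).
    rewrite Eg, Cmod_mult, Cmod_inv, Hz by exact Hzne.
    rewrite <- (Rmult_1_l (/ rho)) at 2; apply Rmult_le_compat_r;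
      [left; apply Rinv_0_lt_compat; lra|apply H1; lra]. }
  rewrite Eg, Cmod_mult, Cmod_inv in H by exact Hune.
  apply (Rmult_le_compat_r (rho * Cmod u)) in H; [|apply Rmult_le_pos; lra].
  replace (/ rho * (rho * Cmod u)) with (Cmod u) in H by (field; lra).
  replace (Cmod (w u) * / Cmod u * (rho * Cmod u)) with (Cmod (w u) * rho) in H
    by (field; lra).
  exact H. }
(* In place of a limit, [rho] is the midpoint of 1 and [Cmod u / Cmod (w u)]. It is at least
   [Cmod u] because [Cmod (w u) <= 1], and it turns [Hrho] into
   [(Cmod (w u) + Cmod u) / 2 <= Cmod u]. *)
apply Rnot_lt_le; intros Hlt.
specialize (H1 u Hu).
assert (Ht : Cmod u / Cmod (w u) < 1).
{ apply (Rmult_lt_reg_r (Cmod (w u))); [lra|]; unfold Rdiv.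
  rewrite Rmult_assoc, Rinv_l by lra; lra. }
assert (Ht' : Cmod u <= Cmod u / Cmod (w u)).
{ apply (Rmult_le_reg_r (Cmod (w u))); [lra|]; unfold Rdiv.
  rewrite Rmult_assoc, Rinv_l by lra; nra. }
specialize (Hrho ((1 + Cmod u / Cmod (w u)) / 2) ltac:(lra)).
replace (Cmod (w u) * ((1 + Cmod u / Cmod (w u)) / 2)) with ((Cmod (w u) + Cmod u) / 2)
  in Hrho by (field; lra).
lra.
Qed.

(* Schwarz's lemma for the Cayley transform [(p - q) / (p + conj q)]. *)
Lemma harnack_lower (p : C -> C) (u : C) :
  (forall z, Cmod z < 1 -> exists l, cderiv p z l) ->
  (forall z, Cmod z < 1 -> 0 <= Re (p z)) ->
  0 < Re (p 0) -> Cmod u < 1 ->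
  Re (p 0) * (1 - Cmod u) <= Re (p u) * (1 + Cmod u).
Proof.
intros Hd Hre Hq Hu.
set (q := p 0%C) in *.
assert (Hadd : forall z, Cmod z < 1 -> Re q + Re (p z) <= Cmod (p z + Cconj q)).
{ intros z Hz; assert (H := re_le_Cmod (p z + Cconj q)).
  apply Rabs_le_between in H.
  change (Re (p z + Cconj q)) with (Re (p z) + Re q) in H; lra. }
assert (Hne : forall z, Cmod z < 1 -> (p z + Cconj q)%C <> 0%C).
{ intros z Hz; apply Cmod_gt_0; specialize (Hadd z Hz); specialize (Hre z Hz); lra. }
(* This identity shows that the Cayley transform has modulus at most 1, and later quantifies by how
   much [Re (p u)] keeps it below 1. *)
assert (Hsq : forall z, Cmod (p z - q) ^ 2 =
  Cmod (p z + Cconj q) ^ 2 - 4 * Re q * Re (p z)).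
{ intros z; rewrite !Cmod2_alt; unfold Cconj, Re, Im; simpl; ring. }
set (w := fun z => ((p z + - q) * / (p z + Cconj q))%C).
assert (Hw : forall z, Cmod z < 1 -> Cmod (w z) * Cmod (p z + Cconj q) = Cmod (p z - q)).
{ intros z Hz; rewrite <- Cmod_mult; f_equal; unfold w; field; apply Hne, Hz. }
assert (Hconst : forall a z, cderiv (fun _ => a) z 0).
{ intros a z; apply (cderiv_ext_loc (fun z => 0 * z + a)%C _ z 0 1); [lra| |apply cderiv_affine].
  intros v _; ring. }
assert (S : Cmod (w u) <= Cmod u).
{ apply schwarz; [| | |exact Hu].
  - intros z Hz; destruct (Hd z Hz) as [l Hl]; eexists; unfold w.
    apply cderiv_mult; [apply cderiv_plus; [exact Hl|apply Hconst]|].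
    apply cderiv_inv; [|apply Hne, Hz].
    apply cderiv_plus; [exact Hl|apply Hconst].
  - unfold w; fold q; ring.
  - intros z Hz; specialize (Hw z Hz); specialize (Hsq z); specialize (Hre z Hz).
    specialize (Hadd z Hz).
    pose proof (Cmod_ge_0 (w z)).
    apply Rnot_lt_le; intros Hlt.
    assert (0 <= 4 * Re q * Re (p z)) by (apply Rmult_le_pos; lra).
    rewrite <- Hw in Hsq; set (M := Cmod (p z + Cconj q)) in *.
    assert (HM : 1 * M < Cmod (w z) * M) by (apply Rmult_lt_compat_r; lra).
    assert (1 * M * (1 * M) < Cmod (w z) * M * (Cmod (w z) * M))
      by (apply Rmult_le_0_lt_compat; lra).
    lra. }
specialize (Hw u Hu); specialize (Hsq u); specialize (Hre u Hu); specialize (Hadd u Hu).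
pose proof (Cmod_ge_0 (w u)) as Hw0; pose proof (Cmod_ge_0 u) as Hu0.
set (P := Re (p u)) in *; set (a := Re q) in *; set (x := Cmod u) in *.
set (M := Cmod (p u + Cconj q)) in *.
assert (H1 : (1 - x ^ 2) * M ^ 2 <= 4 * a * P).
{ assert (Cmod (w u) ^ 2 <= x ^ 2) by (apply pow_incr; lra).
  rewrite <- Hw, Rpow_mult_distr in Hsq.
  pose proof (pow2_ge_0 M); nra. }
assert (H2 : (1 - x ^ 2) * (a + P) ^ 2 <= 4 * a * P).
{ eapply Rle_trans; [|exact H1]; apply Rmult_le_compat_l; [nra|].
  apply pow_incr; lra. }
(* [H2] is a quadratic inequality in [P] whose roots are the two Harnack bounds. If the first factor
   were negative, so would be the second, and the product would be positive. *)
assert (H3 : (P * (1 + x) - a * (1 - x)) * (P * (1 - x) - a * (1 + x)) <= 0) by nra.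
apply Rnot_lt_le; intros Hlt.
assert (P * (1 - x) - a * (1 + x) < 0) by nra.
nra.
Qed.

(** * Resolvents *)

Lemma resolvent_bound (q : C) (f G : C -> C) (r : R) :
  0 < Re q -> generator q f -> resolvent f r G -> 2 / Re q < r ->
  forall z, unit_disk z -> Cmod (G z) <= 3 / (1 + r * Re q).
Proof.
intros Hq (p & Hp & Hre & Hp0 & Hf) (_ & HG & Heq) Hr z Hz.
assert (Hra : 2 < r * Re q).
{ apply (Rmult_lt_compat_r (Re q)) in Hr; [|exact Hq].
  unfold Rdiv in Hr; rewrite Rmult_assoc, Rinv_l in Hr; lra. }
assert (Hr0 : 0 < r) by nra.
specialize (HG z Hz); specialize (Heq z Hz).
set (u := G z) in *.
assert (HH : Re q * (1 - Cmod u) <= Re (p u) * (1 + Cmod u)).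
{ rewrite <- Hp0 in *; apply harnack_lower; [| exact Hre | exact Hq | exact HG].
  intros v Hv; apply cderiv_of_ex_derive, Hp, Hv. }
rewrite (Hf u HG) in Heq.
replace (u + r * (u * p u))%C with (u * (1 + r * p u))%C in Heq by ring.
assert (HRe : 1 + r * Re (p u) <= Cmod (1 + r * p u)).
{ assert (H := re_le_Cmod (1 + r * p u)); apply Rabs_le_between in H.
  replace (Re (1 + r * p u)) with (1 + r * Re (p u)) in H
    by (unfold Re; simpl; ring).
  lra. }
unfold unit_disk in Hz, HG; rewrite <- Heq, Cmod_mult in Hz.
pose proof (Cmod_ge_0 u) as Hx0.
set (x := Cmod u) in *; set (P := Re (p u)) in *; set (a := Re q) in *.
assert (H1 : x * (1 + r * P) < 1).
{ eapply Rle_lt_trans; [|exact Hz]; apply Rmult_le_compat_l; assumption. }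
assert (H2 : x * (1 + x) + x * (r * a * (1 - x)) < 1 + x).
{ apply (Rmult_lt_compat_r (1 + x)) in H1; [|lra].
  apply (Rmult_le_compat_l (x * r)) in HH; [|apply Rmult_le_pos; lra].
  lra. }
(* [H2] says [x * (r * a) * (1 - x) < (1 + x) * (1 - x)], and the factor [1 - x] is positive. *)
assert (H3 : x * (r * a - 1) < 1).
{ apply (Rmult_lt_reg_r (1 - x)); [lra|]; nra. }
apply (Rmult_le_reg_r (1 + r * a)); [lra|].
unfold Rdiv; rewrite Rmult_assoc, Rinv_l by lra; nra.
Qed.

(** A radial limit of values of modulus at most [b] cannot have modulus 1. *)
Lemma no_boundary_fixed_point (G : C -> C) (b : R) :
  b < 1 -> (forall z, unit_disk z -> Cmod (G z) <= b) ->
  ~ exists zeta, boundary_fixed_point G zeta.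
Proof.
intros Hb HG [zeta [Hz Hlim]].
(* Balls of [C] are coordinatewise; the half makes the modulus of the difference less than
   [1 - b]. *)
assert (He : 0 < (1 - b) / 2) by lra.
specialize (Hlim _ (locally_ball zeta (mkposreal _ He))).
destruct Hlim as [d Hd]; pose proof (cond_pos d) as Hdp.
pose proof (Rmin_l d 1); pose proof (Rmin_r d 1).
assert (0 < Rmin d 1) by (apply Rmin_glb_lt; lra).
(* A parameter in [(0, 1)] at distance less than [d] from 1. *)
set (s := 1 - Rmin d 1 / 2).
assert (Hball : ball zeta ((1 - b) / 2) (G (s * zeta)%C)).
{ apply (Hd s); [|unfold s; lra].
  change (Rabs (s - 1) < d); unfold s; rewrite Rabs_left; lra. }
assert (Hs : Cmod (G (s * zeta)%C) <= b).
{ apply HG; unfold unit_disk; rewrite Cmod_mult, Cmod_R, Hz, Rabs_pos_eq; unfold s; lra. }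
destruct Hball as [B1 B2].
change (Rabs (Re (G (s * zeta)%C) - Re zeta) < (1 - b) / 2) in B1.
change (Rabs (Im (G (s * zeta)%C) - Im zeta) < (1 - b) / 2) in B2.
set (y := G (s * zeta)%C) in *.
assert (T := Cmod_le_2Rmax (y - zeta)).
change (Re (y - zeta)) with (Re y - Re zeta) in T.
change (Im (y - zeta)) with (Im y - Im zeta) in T.
pose proof (Rmax_lub_lt _ _ _ B1 B2).
assert (T' := Cmod_triangle y (- (y - zeta))); rewrite Cmod_opp in T'.
replace (y + - (y - zeta))%C with zeta in T' by ring; lra.
Qed.

Theorem corollary3p1 :
  forall (q : C) (f : C -> C) (G : R -> C -> C),
    (0 < Re q)%R ->
    generator q f ->
    (forall r : R, (0 < r)%R -> resolvent f r (G r)) ->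
    (forall r : R, (2 / Re q < r)%R ->
       (forall z : C, unit_disk z -> (Cmod (G r z) <= 3 / (1 + r * Re q))%R) /\
       ~ (exists zeta : C, boundary_fixed_point (G r) zeta)) /\
    unif_cvg_at_infty unit_disk G (fun _ : C => RtoC 0).
Proof.
intros q f G Hq Hf HG.
assert (Hq2 : 0 < 2 / Re q) by (apply Rdiv_lt_0_compat; lra).
assert (Hbound : forall r, 2 / Re q < r -> forall z, unit_disk z ->
  Cmod (G r z) <= 3 / (1 + r * Re q)).
{ intros r Hr; apply (resolvent_bound q f); try assumption; apply HG; lra. }
split.
- intros r Hr; split; [exact (Hbound r Hr)|].
  apply (no_boundary_fixed_point _ (3 / (1 + r * Re q))); [|exact (Hbound r Hr)].
  apply (Rmult_lt_compat_r (Re q)) in Hr; [|exact Hq].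
  unfold Rdiv in Hr; rewrite Rmult_assoc, Rinv_l in Hr by lra.
  apply (Rmult_lt_reg_r (1 + r * Re q)); [lra|].
  unfold Rdiv; rewrite Rmult_assoc, Rinv_l; lra.
- intros eps; pose proof (cond_pos eps) as He.
  (* The first threshold makes the bound available, the second makes [3 / (r * Re q)] smaller than
     [eps]. *)
  exists (Rmax (2 / Re q) (3 / eps / Re q)); intros r Hr z Hz.
  assert (Hr1 := Rle_lt_trans _ _ _ (Rmax_l _ _) Hr).
  assert (Hr2 := Rle_lt_trans _ _ _ (Rmax_r _ _) Hr).
  replace (G r z - RtoC 0)%C with (G r z) by ring.
  eapply Rle_lt_trans; [exact (Hbound r Hr1 z Hz)|].
  assert (Hra : 3 < eps * (r * Re q)).
  { apply (Rmult_lt_compat_r (eps * Re q)) in Hr2; [|apply Rmult_lt_0_compat; lra].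
    replace (3 / eps / Re q * (eps * Re q)) with 3 in Hr2 by (field; lra); lra. }
  assert (0 < r * Re q) by (apply Rmult_lt_0_compat; lra).
  apply (Rmult_lt_reg_r (1 + r * Re q)); [lra|].
  unfold Rdiv; rewrite Rmult_assoc, Rinv_l; lra.
Qed.
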